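(* Let $1\le m\le n$ and let $\mathfrak{P}_0$ be a convex subset of the set $\mathfrak{P}_n$ of $n$-variate probability distributions with the property $$\Delta^\pm(\bar p,\bar q)\in\mathfrak{P}_0\quad\text{for any }\bar p,\bar q\in\mathfrak{P}_0\text{ such that }\bar p\ne\bar q,$$ where $\Delta^+(\bar p,\bar q)$ and $\Delta^-(\bar p,\bar q)$ are the $n$-variate probability distributions with the entries $c[p_{i_1,\dots,i_n}-q_{i_1,\dots,i_n}]_+$ and $c[q_{i_1,\dots,i_n}-p_{i_1,\dots,i_n}]_+$, $c=1/\mathrm{TV}(\bar p,\bar q)$, $[x]_+=\max\{x,0\}$. A) If $f$ is a function in $T^m_n(C,D|\mathfrak{P}_0)$ then $$|f(\bar p)-f(\bar q)|\le C\varepsilon\ln d_m(\bar p,\bar q)+Dg(\varepsilon)$$ for any distributions $\bar p,\bar q\in\mathfrak{P}_0$ such that $d_m(\bar p,\bar q)=\max\{\prod_{k=1}^m|\bar p_k|,\prod_{k=1}^m|\bar q_k|\}$ is finite and $\mathrm{TV}(\bar p,\bar q)\le\varepsilon$, where $|\bar p_k|$ and $|\bar q_k|$ are the numbers of nonzero entries of the $1$-variate marginal distributions $\bar p_k$ and $\bar q_k$ corresponding to the $k$-th component. B) If $f$ is a nonnegative function in $T^m_n(C,D|\mathfrak{P}_0)$ and $\bar p$ is a distribution in $\mathfrak{P}_0$ such that $d_m(\bar p)=\prod_{k=1}^m|\bar p_k|$ is finite, then $$f(\bar p)-f(\bar q)\le C\varepsilon\ln d_m(\bar p)+Dg(\varepsilon)$$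 for any distribution $\bar q\in\mathfrak{P}_0$ such that $\mathrm{TV}(\bar p,\bar q)\le\varepsilon$ (the left-hand side may be equal to $-\infty$).
   Context: $\mathfrak{P}_n$ is the set of probability distributions $\bar p=\{p_{i_1,\dots,i_n}\}_{(i_1,\dots,i_n)\in\mathbb{N}^n}$ on $\mathbb{N}^n$. $\bar p_k$ denotes the marginal distribution of $\bar p$ corresponding to the $k$-th component. $\mathrm{TV}(\bar p,\bar q)=\frac12\sum_{i_1,\dots,i_n}|p_{i_1,\dots,i_n}-q_{i_1,\dots,i_n}|$. $H(\{r_i\})=-\sum_ir_i\ln r_i\in[0,+\infty]$ is the Shannon entropy, $h_2(\lambda)=-\lambda\ln\lambda-(1-\lambda)\ln(1-\lambda)$ the binary entropy, $g(x)=(x+1)\ln(x+1)-x\ln x$ for $x>0$, $g(0)=0$. Class $T^m_n(C,D|\mathfrak{P}_0)$: all functions $f:\mathfrak{P}_0\to(-\infty,+\infty]$ for which there are nonnegative numbers $c_f^\pm,d_f^\pm$ with $c_f^-+c_f^+=C$, $d_f^-+d_f^+=D$ such that for all $\bar p,\bar q\in\mathfrak{P}_0$, $\lambda\in[0,1]$ $$\lambda f(\bar p)+(1-\lambda)f(\bar q)-d_f^-h_2(\lambda)\le f(\lambda\bar p+(1-\lambda)\bar q)\le\lambda f(\bar p)+(1-\lambda)f(\bar q)+d_f^+h_2(\lambda),$$ $$-c_f^-\sum_{k=1}^mH(\bar p_k)\le f(\bar p)\le c_f^+\sum_{k=1}^mH(\bar p_k),$$ with possible infinite values in all sides (convention $0\cdot(+\infty)=0$).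 *)

(* Defs.v *)
From HB Require Import structures.
From mathcomp Require Import all_boot all_order all_algebra.
From mathcomp Require Import all_classical all_reals all_analysis.

Set Implicit Arguments.
Unset Strict Implicit.
Unset Printing Implicit Defensive.

Import Order.TTheory GRing.Theory Num.Theory.
Import numFieldNormedType.Exports.

Local Open Scope classical_set_scope.
Local Open Scope ring_scope.

(* A multi-index (i_1, ..., i_n) is a finite function; components are numbered
   from 0, so "the first m components" are the k : 'I_n with k < m. *)
Notation multiindex n := {ffun 'I_n -> nat}.

Definition distributions (R : realType) (n : nat) : set (multiindex n -> R) :=
  [set p | (forall i, 0 <= p i) /\ (\esum_(i in [set: multiindex n]) (p i)%:E = 1)%E].

Definition marginal (R : realType) (n : nat) (k : 'I_n) (p : multiindex n -> R) :
    nat -> R :=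
  fun j => fine (\esum_(i in [set i : multiindex n | i k = j]) (p i)%:E)%E.

Definition TV (R : realType) (n : nat) (p q : multiindex n -> R) : R :=
  2^-1 * fine (\esum_(i in [set: multiindex n]) `|p i - q i|%:E)%E.

Definition Delta_plus (R : realType) (n : nat) (p q : multiindex n -> R) :
    multiindex n -> R :=
  fun i => (TV p q)^-1 * Num.max (p i - q i) 0.

Definition Delta_minus (R : realType) (n : nat) (p q : multiindex n -> R) :
    multiindex n -> R :=
  fun i => (TV p q)^-1 * Num.max (q i - p i) 0.

(* In this and the next two definitions ln 0 is a real number (0 in the
   library), so that 0 * ln 0 = 0. *)
Definition entropy (R : realType) (r : nat -> R) : \bar R :=
  (\esum_(i in [set: nat]) (- (r i * ln (r i)))%:E)%E.

Definition h2 (R : realType) (l : R) : R :=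
  - (l * ln l) - (1 - l) * ln (1 - l).

Definition g (R : realType) (x : R) : R :=
  (x + 1) * ln (x + 1) - x * ln x.

Definition marginal_entropies (R : realType) (n m : nat) (p : multiindex n -> R) :
    \bar R :=
  (\sum_(k < n | (k < m)%N) entropy (marginal k p))%E.

(* The value is +oo when r has infinitely many nonzero entries *)
Definition nb_nonzero (R : realType) (r : nat -> R) : \bar R :=
  counting [set j | r j != 0].

Definition dm (R : realType) (n m : nat) (p : multiindex n -> R) : \bar R :=
  (\prod_(k < n | (k < m)%N) nb_nonzero (marginal k p))%E.

Definition dm2 (R : realType) (n m : nat) (p q : multiindex n -> R) : \bar R :=
  maxe (dm m p) (dm m q).

(* The class T^m_n(C, D | P0). A function on P0 is represented by a function on
   the whole type whose values outside P0 are irrelevant: for convex P0, only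
   values of f on P0 occur below. The library's 0 * (+oo) is 0. *)
Definition Tclass (R : realType) (n m : nat) (C D : R)
    (P0 : set (multiindex n -> R)) : set ((multiindex n -> R) -> \bar R) :=
  [set f |
    (forall p, P0 p -> f p != -oo%E) /\
    exists cneg cpos dneg dpos : R,
    [/\ [/\ 0 <= cneg, 0 <= cpos, 0 <= dneg & 0 <= dpos],
        cneg + cpos = C,
        dneg + dpos = D,
        (forall (p q : multiindex n -> R) (l : R), P0 p -> P0 q -> 0 <= l <= 1 ->
          (l%:E * f p + (1 - l)%:E * f q - (dneg * h2 l)%:E
             <= f (l *: p + (1 - l) *: q)%R)%E /\
          (f (l *: p + (1 - l) *: q)%R
             <= l%:E * f p + (1 - l)%:E * f q + (dpos * h2 l)%:E)%E)
      & (forall p : multiindex n -> R, P0 p ->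
          (- (cneg%:E * marginal_entropies m p) <= f p)%E /\
          (f p <= cpos%:E * marginal_entropies m p)%E)]].

(* Main.v *)
Require Import Defs.
From HB Require Import structures.
From mathcomp Require Import all_boot all_order all_algebra finmap.
From mathcomp Require Import all_classical all_reals all_analysis.
From mathcomp Require Import ring lra.

Set Implicit Arguments.
Unset Strict Implicit.
Unset Printing Implicit Defensive.

Import Order.TTheory GRing.Theory Num.Theory.
Import numFieldNormedType.Exports.

Local Open Scope classical_set_scope.
Local Open Scope ring_scope.

(* With [e = TV p q] and [D+-] for [Delta_plus p q], [Delta_minus p q], one has
   [p + e D- = max(p, q) = q + e D+], so [p] mixed with [D-] and [q] mixed with
   [D+], both with weight [l = 1/(1+e)] on the first component, are the same
   distribution.  Comparing the two mixing bounds on [f] there gives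
     f p - f q <= e (f D+ - f D-) + D (1+e) h2(l),  and  (1+e) h2(l) = g e.
   As [D+] vanishes where [p] does and [D-] where [q] does, the marginal
   entropies in the bounds on [f D+] and [f D-] are at most the logarithms of
   the support sizes of the marginals of [p] and [q]; in part B, [f D- >= 0]
   is used instead. *)

(** * Logarithmic inequalities and the functions [g] and [h2] *)

(** One term of Gibbs' inequality: [ln t <= t - 1] at [t = y / x], multiplied by [x]. *)
Lemma mulr_ln_sub_le (R : realType) (x y : R) :
  0 <= x -> 0 < y -> x * (ln y - ln x) <= y - x.
Proof.
rewrite le_eqVlt => /predU1P[<-|x_gt0] y_gt0; first by rewrite mul0r subr0 ltW.
have -> : y - x = x * (y / x - 1) by field; rewrite gt_eqF.
rewrite ler_pM2l// -ln_div ?posrE// -[in leLHS](subrKC 1 (y / x)).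
by apply: le_ln1Dx; rewrite ltrBrDl subrr divr_gt0.
Qed.

(** Gibbs' inequality against the uniform distribution: [mulr_ln_sub_le] with [y = N^-1] bounds each
    term, and in the sum [N * N^-1] cancels the total mass 1. *)
Lemma sum_entropy_le_ln_size (R : realType) (I : eqType) (s : seq I)
    (r : I -> R) :
  (forall i, 0 <= r i) -> \sum_(i <- s) r i = 1 ->
  \sum_(i <- s) - (r i * ln (r i)) <= ln (size s)%:R.
Proof.
move=> r_ge0 r_sum.
have N_gt0 : 0 < (size s)%:R :> R.
  rewrite ltr0n lt0n; apply/negP => /nilP s_nil.
  by move: r_sum; rewrite s_nil big_nil => /esym/eqP; rewrite oner_eq0.
set N := (size s)%:R in N_gt0 *.
have le_term i : - (r i * ln (r i)) <= r i * ln N + N^-1 - r i.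
  have := @mulr_ln_sub_le _ (r i) N^-1 (r_ge0 i).
  by rewrite invr_gt0 lnV ?posrE// => /(_ N_gt0); lra.
apply: (le_trans (ler_sum _ (fun i _ => le_term i))).
rewrite sumrB big_split/= -mulr_suml r_sum big_const_seq count_predT iter_addr.
by rewrite addr0 -(mulr_natr N^-1) -/N mulVf ?gt_eqF// mul1r addrK.
Qed.

(* By [mulr_ln_sub_le], [g x <= - ln s - x * ln (1 - s)] for all [0 < s < 1],
   with equality at [s = (1 + x)^-1], and the bound increases with [x]. *)
Lemma g_homo (R : realType) (x y : R) : 0 <= x -> x <= y -> g x <= g y.
Proof.
move=> x_ge0 le_xy.
have [->//|neq_xy] := eqVneq x y.
have y_gt0 : 0 < y by rewrite (le_lt_trans x_ge0)// lt_neqAle neq_xy.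
have x1_gt0 : 0 < x + 1 by rewrite ltr_wpDl.
have y1_gt0 : 0 < y + 1 by rewrite ltr_wpDl// ltW.
pose w := (x + 1) / (y + 1).
have w_gt0 : 0 < w by rewrite divr_gt0.
have ln_w : ln w = ln (x + 1) - ln (y + 1) by rewrite ln_div ?posrE.
have gibbs1 := mulr_ln_sub_le ler01 w_gt0.
have gibbsx := mulr_ln_sub_le x_ge0 (mulr_gt0 y_gt0 w_gt0).
rewrite lnM ?posrE// in gibbsx; rewrite ln1 in gibbs1.
have w_def : y * w + w = x + 1 by rewrite /w; field; rewrite gt_eqF.
have ln_mono : 0 <= (y - x) * (ln (y + 1) - ln y).
  by rewrite mulr_ge0 ?subr_ge0// ler_ln ?posrE// lerDl.
by rewrite /g; move: gibbs1 gibbsx ln_mono; rewrite ln_w; lra.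
Qed.

Lemma g0 (R : realType) : g 0 = 0 :> R.
Proof. by rewrite /g add0r ln1 mulr0 mul0r subrr. Qed.

Lemma h2_inv1D (R : realType) (x : R) :
  0 < x -> (1 + x) * h2 (1 + x)^-1 = g x.
Proof.
move=> x_gt0; have x1_gt0 : 0 < 1 + x by rewrite addr_gt0.
have -> : h2 (1 + x)^-1 =
    - ((1 + x)^-1 * ln (1 + x)^-1) - x / (1 + x) * ln (x / (1 + x)).
  have -> : x / (1 + x) = 1 - (1 + x)^-1 by field; rewrite gt_eqF.
  by [].
rewrite /g (addrC x) ln_div ?posrE// lnV ?posrE//.
by field; rewrite gt_eqF.
Qed.

(** * Entropy of distributions with finite support *)

Lemma esum_finite_support (R : realType) (I : choiceType) (A : set I)
    (a : I -> \bar R) :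
  finite_set A -> (forall i, 0 <= a i)%E -> (forall i, ~ A i -> a i = 0%E) ->
  (\esum_(i in [set: I]) a i = \sum_(i <- fset_set A) a i)%E.
Proof.
move=> finA a_ge0 a0; rewrite -fsbig_finite// -esum_fset//.
rewrite [RHS]esum_mkcond; apply: eq_esum => i _.
by case: ifPn => //; rewrite notin_setE => /a0.
Qed.

(** [A] need only contain the support of [r]: it will be the support of a marginal of [p], while [r]
    is a marginal of another distribution dominated by [p]. *)
Lemma entropy_le_ln_card (R : realType) (A : set nat) (r : nat -> R) :
  finite_set A -> (forall j, 0 <= r j) -> (forall j, ~ A j -> r j = 0) ->
  (\esum_(j in [set: nat]) (r j)%:E = 1)%E ->
  (entropy r <= (ln (#|` fset_set A|)%:R)%:E)%E.
Proof.
move=> finA r_ge0 r0 r_sum.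
(* This makes the entropy terms nonnegative, as the reduction to a finite sum requires. *)
have r_le1 j : r j <= 1.
  rewrite -lee_fin -r_sum esum_ge//; exists [set j] => //.
  by rewrite fsbig_set1.
have sumA : \sum_(j <- fset_set A) r j = 1.
  have := r_sum; rewrite (@esum_finite_support _ _ A)//.
    by rewrite sumEFin => -[].
  by move=> j /r0 ->.
rewrite /entropy (@esum_finite_support _ _ A)//.
- by rewrite sumEFin lee_fin; exact: sum_entropy_le_ln_size.
- by move=> j; rewrite lee_fin -mulrN mulr_ge0// oppr_ge0 ln_le0.
- by move=> j /r0 ->; rewrite mul0r oppr0.
Qed.

(** * Marginals of a distribution *)

Section Marginals.
Variables (R : realType) (n : nat) (p : multiindex n -> R).
Hypothesis p_distr : distributions p.

Let p_ge0 i : (0 <= (p i)%:E)%E.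
Proof. by rewrite lee_fin; case: p_distr. Qed.

(** No value is lost by [fine]: the sum over a fiber is at most the total mass 1. *)
Lemma marginalE (k : 'I_n) j :
  ((marginal k p j)%:E = \esum_(i in [set i : multiindex n | i k = j]) (p i)%:E)%E.
Proof.
rewrite /marginal fineK// ge0_fin_numE ?esum_ge0//.
apply: (@le_lt_trans _ _ 1%E); last exact: ltry.
case: p_distr => _ <-; rewrite esum_mkcond; apply: le_esum => i _.
by case: ifP.
Qed.

Lemma marginal_ge0 (k : 'I_n) j : 0 <= marginal k p j.
Proof. by rewrite -lee_fin marginalE esum_ge0. Qed.

(** The fibers of [i |-> i k] partition the multi-indices. *)
Lemma marginal_sum1 (k : 'I_n) :
  (\esum_(j in [set: nat]) (marginal k p j)%:E = 1)%E.
Proof.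
case: p_distr => _ <-; under eq_esum do rewrite marginalE.
rewrite -esum_bigcupT//; last by move=> i j _ _ [x [/= <- <-]].
congr (esum _ _); apply/seteqP; split=> // i _.
by exists (i k).
Qed.

Lemma marginal_eq0 (k : 'I_n) j :
  marginal k p j = 0 -> forall i : multiindex n, i k = j -> p i = 0.
Proof.
move=> pj0 i ikj; apply/eqP; rewrite eq_le -!lee_fin p_ge0 andbT.
rewrite -pj0 marginalE esum_ge//; exists [set i]; last by rewrite fsbig_set1.
by split=> // _ ->.
Qed.

(** A marginal with empty support would have mass 0 instead of 1. Hence no factor of [dm] can
    annihilate an infinite one. *)
Lemma nb_nonzero_marginal_ge1 (k : 'I_n) :
  (1 <= nb_nonzero (marginal k p))%E.
Proof.
rewrite /nb_nonzero /counting; case: asboolP => [finA|_]; last exact: leey.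
rewrite lee_fin ler1n lt0n cardfs_eq0; apply/negP => /eqP A0.
have := marginal_sum1 k.
rewrite esum1 => [/esym/eqP|j _]; first by rewrite onee_eq0.
apply/eqP; rewrite eqe; apply: contraT => pj.
have : j \in fset_set [set j | marginal k p j != 0] by rewrite in_fset_set// inE.
by rewrite A0 inE.
Qed.

End Marginals.

(** * Support sizes against marginal entropies *)

Lemma ln_prod (R : realType) (I : Type) (s : seq I) (P : pred I) (F : I -> R) :
  (forall i, P i -> 0 < F i) ->
  ln (\prod_(i <- s | P i) F i) = \sum_(i <- s | P i) ln (F i).
Proof.
move=> F_gt0.
(* The induction carries the positivity of the partial products, which [lnM] requires. *)
suff [] : 0 < \prod_(i <- s | P i) F i /\
  ln (\prod_(i <- s | P i) F i) = \sum_(i <- s | P i) ln (F i) by [].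
elim/big_rec2: _ => [|i y x /F_gt0 Fi_gt0 [y_gt0 <-]]; first by rewrite ln1.
by split; [exact: mulr_gt0 | rewrite lnM ?posrE].
Qed.

Lemma prode_ge1 (R : realType) (I : Type) (s : seq I) (P : pred I)
    (F : I -> \bar R) :
  (forall i, P i -> 1 <= F i)%E -> (1 <= \prod_(i <- s | P i) F i)%E.
Proof.
move=> F_ge1; elim/big_ind: _ => // x y x_ge1 y_ge1.
by rewrite -[leLHS]mule1 lee_pmul.
Qed.

Section SupportSize.
Variables (R : realType) (n m : nat) (p : multiindex n -> R).
Hypothesis p_distr : distributions p.
Hypothesis dm_fin : (dm m p < +oo)%E.

Let supp k : set nat := [set j | marginal k p j != 0].

Let N k : R := (#|` fset_set (supp k)|)%:R.

Let nb_nonzero_ge1 k : (1 <= nb_nonzero (marginal k p))%E.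
Proof. exact: nb_nonzero_marginal_ge1. Qed.

Let finite_supp (k : 'I_n) : (k < m)%N -> finite_set (supp k).
Proof.
move=> km; apply: contrapT => infin.
suff dm_oo : (dm m p = +oo)%E by have := dm_fin; rewrite dm_oo ltxx.
(* One infinite factor times a product that is at least 1 is infinite. *)
rewrite /dm (bigD1 k)//= {1}/nb_nonzero /counting asboolF// gt0_mulye//.
by rewrite (@lt_le_trans _ _ 1%E) ?prode_ge1.
Qed.

Let nb_nonzeroE (k : 'I_n) : (k < m)%N -> nb_nonzero (marginal k p) = (N k)%:E.
Proof. by move=> km; rewrite /nb_nonzero /counting asboolT//; exact: finite_supp. Qed.

Let N_gt0 (k : 'I_n) : (k < m)%N -> 0 < N k.
Proof.
move=> km; have := nb_nonzero_ge1 k; rewrite nb_nonzeroE// lee_fin.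
exact: lt_le_trans.
Qed.

Lemma dm_fin_num : dm m p \is a fin_num.
Proof. by rewrite ge0_fin_numE// prode_ge0// => k _; rewrite (le_trans lee01). Qed.

Lemma fine_dm_ge1 : 1 <= fine (dm m p).
Proof. by rewrite -lee_fin fineK ?dm_fin_num ?prode_ge1. Qed.

Lemma ln_dm_ge0 : 0 <= ln (fine (dm m p)).
Proof. by rewrite ln_ge0// fine_dm_ge1. Qed.

(** The support of each marginal of [r] lies in that of [p], so its entropy is at most the logarithm
    of the size of the latter; these logarithms add up to that of the product. *)
Lemma marginal_entropies_le_ln_dm (r : multiindex n -> R) :
  distributions r -> (forall i, p i = 0 -> r i = 0) ->
  (marginal_entropies m r <= (ln (fine (dm m p)))%:E)%E.
Proof.
move=> r_distr r0.
have -> : fine (dm m p) = \prod_(k < n | (k < m)%N) N k.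
  by rewrite /dm (eq_bigr _ nb_nonzeroE) prodEFin.
rewrite ln_prod// -sumEFin; apply: lee_sum => k km.
apply: entropy_le_ln_card; [exact: finite_supp|exact: marginal_ge0| |].
(* A zero of a marginal of [p] forces [p], hence [r], to vanish on the whole fiber. *)
- move=> j /negP; rewrite negbK => /eqP pj0.
  rewrite /marginal esum1// => i ikj.
  by rewrite r0//; exact: (marginal_eq0 p_distr pj0).
- exact: marginal_sum1.
Qed.

End SupportSize.

(** * Total variation and the distributions [Delta_plus], [Delta_minus] *)

Lemma TVC (R : realType) (n : nat) (p q : multiindex n -> R) : TV p q = TV q p.
Proof. by rewrite /TV; under eq_esum do rewrite distrC. Qed.

Lemma TV_ge0 (R : realType) (n : nat) (p q : multiindex n -> R) : 0 <= TV p q.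
Proof.
by rewrite mulr_ge0 ?invr_ge0 ?ler0n// fine_ge0// esum_ge0// => i _; rewrite lee_fin.
Qed.

(* [Delta_plus p q] is the null function when [TV p q = 0]. *)
Lemma TV_gt0 (R : realType) (n : nat) (p q : multiindex n -> R) :
  distributions (Delta_plus p q) -> 0 < TV p q.
Proof.
case=> _ sum1; rewrite lt_neqAle TV_ge0 andbT; apply/eqP => TV0.
move: sum1; rewrite esum1 => [/esym/eqP|i _]; first by rewrite onee_eq0.
by rewrite /Delta_plus -TV0 invr0 mul0r.
Qed.

Lemma Delta_mixture (R : realType) (n : nat) (p q : multiindex n -> R) :
  0 < TV p q ->
  let l := (1 + TV p q)^-1 in
  l *: p + (1 - l) *: Delta_minus p q = l *: q + (1 - l) *: Delta_plus p q.
Proof.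
move=> TV_gt0 l.
(* As [1 - l = l * TV p q], the normalization of the Delta distributions cancels and both sides
   become [l] times the pointwise maximum of [p] and [q]. *)
have l1 : (1 - l) * (TV p q)^-1 = l.
  by rewrite /l; field; rewrite !gt_eqF// addr_gt0.
apply/funext => i; rewrite /Delta_minus /Delta_plus/= !fctE.
rewrite -![_ *: _]/(_ * _) !mulrA l1 -!mulrDr; congr (_ * _).
by rewrite !maxEle; case: ifP; case: ifP; lra.
Qed.

(** * The one-sided estimate *)

Section OneSided.
Variables (R : realType) (n m : nat) (P0 : set (multiindex n -> R)).
Hypothesis P0_distr : P0 `<=` @distributions R n.
Hypothesis P0_Delta : forall p q : multiindex n -> R, P0 p -> P0 q -> p <> q ->
  P0 (Delta_plus p q) /\ P0 (Delta_minus p q).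
Variables (f : (multiindex n -> R) -> \bar R) (cpos dneg dpos : R).
Hypothesis cpos_ge0 : 0 <= cpos.
Hypothesis dneg_ge0 : 0 <= dneg.
Hypothesis dpos_ge0 : 0 <= dpos.
Hypothesis f_neqNy : forall p, P0 p -> f p != -oo%E.
Hypothesis f_mix : forall (p q : multiindex n -> R) (l : R),
  P0 p -> P0 q -> 0 <= l <= 1 ->
  (l%:E * f p + (1 - l)%:E * f q - (dneg * h2 l)%:E
     <= f (l *: p + (1 - l) *: q)%R)%E /\
  (f (l *: p + (1 - l) *: q)%R
     <= l%:E * f p + (1 - l)%:E * f q + (dpos * h2 l)%:E)%E.
Hypothesis f_le : forall p, P0 p ->
  (f p <= cpos%:E * marginal_entropies m p)%E.

Lemma f_le_ln_dm (p r : multiindex n -> R) :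
  P0 p -> P0 r -> (dm m p < +oo)%E -> (forall i, p i = 0 -> r i = 0) ->
  (f r <= (cpos * ln (fine (dm m p)))%:E)%E.
Proof.
move=> Pp Pr dm_fin r0; apply: (le_trans (f_le Pr)).
rewrite EFinM lee_wpmul2l ?lee_fin// marginal_entropies_le_ln_dm//; exact: P0_distr.
Qed.

Lemma f_fin_num (p : multiindex n -> R) :
  P0 p -> (dm m p < +oo)%E -> f p \is a fin_num.
Proof.
move=> Pp dm_fin; rewrite fin_numE f_neqNy//=.
by rewrite lt_eqF// (le_lt_trans (f_le_ln_dm Pp Pp dm_fin _)) ?ltry.
Qed.

(** The lower bound [- K] on [f (Delta_minus p q)] is left as a parameter so that both parts are
    covered: [K = cneg * ln (fine (dm m q))] for A and [K = 0] for B. *)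
Lemma f_diff_le (K : R) (p q : multiindex n -> R) (eps : R) :
  0 <= K -> P0 p -> P0 q -> (dm m p < +oo)%E -> TV p q <= eps ->
  (p <> q -> ((- K)%:E <= f (Delta_minus p q))%E) ->
  (f p - f q <= ((cpos * ln (fine (dm m p)) + K) * eps
                 + (dneg + dpos) * g eps)%:E)%E.
Proof.
move=> K_ge0 Pp Pq dm_fin le_eps K_le.
set L := cpos * ln _.
have L_ge0 : 0 <= L by rewrite mulr_ge0// ln_dm_ge0//; exact: P0_distr.
have eps_ge0 : 0 <= eps := le_trans (TV_ge0 p q) le_eps.
have g_ge0 : 0 <= g eps by rewrite -(g0 R) g_homo.
have /fineK fpE := f_fin_num Pp dm_fin.
set a := fine (f p) in fpE.
have [<-|/eqP neq_pq] := eqVneq p q.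
  rewrite -fpE -EFinB subrr lee_fin.
  by rewrite addr_ge0// mulr_ge0// addr_ge0.
have [PDp PDm] := P0_Delta Pp Pq neq_pq.
have e_gt0 := TV_gt0 (P0_distr PDp).
set e := TV p q in le_eps e_gt0.
have Dp0 i : p i = 0 -> Delta_plus p q i = 0.
  move=> pi0; rewrite /Delta_plus pi0 sub0r max_r ?mulr0// oppr_le0.
  by case: (P0_distr Pq).
have fDp_le := f_le_ln_dm Pp PDp dm_fin Dp0.
have fDm_ge := K_le neq_pq.
(* Possible only when [dm m q] is infinite; the left side is then [-oo]. *)
have [fq_oo|fq_oo] := eqVneq (f q) +oo%E.
  by rewrite fq_oo -fpE leNye.
have /fineK fqE : f q \is a fin_num by rewrite fin_numE f_neqNy.
set b := fine (f q) in fqE.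
pose l := (1 + e)^-1.
have e1_gt0 : 0 < 1 + e by rewrite addr_gt0.
have l_ge0 : 0 <= l by rewrite invr_ge0 ltW.
have l_le1 : l <= 1 by rewrite invf_le1// lerDl ltW.
have l01 : 0 <= l <= 1 by rewrite l_ge0.
have l1_ge0 : 0 <= 1 - l by rewrite subr_ge0.
have [lower _] := f_mix Pp PDm l01; have [_ upper] := f_mix Pq PDp l01.
(* Both sides bound [f] at the common mixture given by [Delta_mixture]. *)
have chain : l * a + (1 - l) * - K - dneg * h2 l
    <= l * b + (1 - l) * L + dpos * h2 l.
  rewrite -lee_fin EFinB (EFinD (l * a)) (EFinD (l * b + _)) (EFinD (l * b)).
  rewrite (EFinM l) (EFinM (1 - l)) (EFinM l b) (EFinM (1 - l) L) fpE fqE.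
  apply: (@le_trans _ _ (f (l *: p + (1 - l) *: Delta_minus p q))).
    by apply: le_trans lower; rewrite leeD// leeD// lee_wpmul2l.
  rewrite Delta_mixture//; apply: (le_trans upper).
  by rewrite leeD// leeD// lee_wpmul2l.
(* Multiply [chain] by [1 + e], using [(1 + e) * l = 1] and [(1 + e) * (1 - l) = e]. *)
have diff_le : a - b <= e * (L + K) + (dneg + dpos) * g e.
  have e1l : (1 + e) * l = 1 by rewrite mulfV ?gt_eqF.
  have := ler_wpM2l (ltW e1_gt0) chain.
  have := h2_inv1D e_gt0; rewrite -/l => <-.
  have -> : (1 + e) * (l * a + (1 - l) * - K - dneg * h2 l)
     = ((1 + e) * l) * (a + K) - (1 + e) * K - (1 + e) * dneg * h2 l by ring.
  have -> : (1 + e) * (l * b + (1 - l) * L + dpos * h2 l)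
     = ((1 + e) * l) * (b - L) + (1 + e) * L + (1 + e) * dpos * h2 l by ring.
  by rewrite e1l; lra.
(* Pass from [e] to [eps]: [L + K] is nonnegative and [g] is monotone. *)
rewrite -fpE -fqE -EFinB lee_fin (le_trans diff_le)// (mulrC e) lerD//.
- by rewrite ler_wpM2l// addr_ge0.
- by rewrite ler_wpM2l ?addr_ge0// g_homo// ltW.
Qed.

End OneSided.

Theorem proposition5 (R : realType) (n m : nat) (m_ge1 : (1 <= m)%N)
    (m_le_n : (m <= n)%N) (P0 : set (multiindex n -> R))
    (P0_distr : P0 `<=` @distributions R n)
    (P0_convex : convex_set P0)
    (P0_Delta : forall p q : multiindex n -> R, P0 p -> P0 q -> p <> q ->
       P0 (Delta_plus p q) /\ P0 (Delta_minus p q))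
    (C D : R) (f : (multiindex n -> R) -> \bar R)
    (f_T : Tclass m C D P0 f) :
  (forall (p q : multiindex n -> R) (eps : R), P0 p -> P0 q ->
     (dm2 m p q < +oo)%E -> TV p q <= eps ->
     (`| f p - f q | <= (C * eps * ln (fine (dm2 m p q)) + D * g eps)%:E)%E)
  /\
  ((forall p, P0 p -> (0 <= f p)%E) ->
   forall p : multiindex n -> R, P0 p -> (dm m p < +oo)%E ->
   forall (q : multiindex n -> R) (eps : R), P0 q -> TV p q <= eps ->
     (f p - f q <= (C * eps * ln (fine (dm m p)) + D * g eps)%:E)%E).
Proof.
case: f_T => f_neqNy [cneg] [cpos] [dneg] [dpos].
case=> -[cneg_ge0 cpos_ge0 dneg_ge0 dpos_ge0] <- <- f_mix f_bounds.
have f_le p (Pp : P0 p) := (f_bounds p Pp).2.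
have diff_le := f_diff_le P0_distr P0_Delta cpos_ge0 dneg_ge0 dpos_ge0
  f_neqNy f_mix f_le.
split=> [p q eps Pp Pq dm2_fin le_eps|f_ge0 p Pp dm_fin q eps Pq le_eps].
  (* The bound is symmetric in the two distributions, so the absolute value follows from this
     one-sided form applied in both orders. *)
  have half p' q' : P0 p' -> P0 q' -> (dm2 m p' q' < +oo)%E -> TV p' q' <= eps ->
      (f p' - f q' <= ((cneg + cpos) * eps * ln (fine (dm2 m p' q'))
                       + (dneg + dpos) * g eps)%:E)%E.
    move=> {}Pp {}Pq + {}le_eps; rewrite {1}/dm2 gt_max => /andP[dmp_fin dmq_fin].
    have eps_ge0 : 0 <= eps := le_trans (TV_ge0 p' q') le_eps.
    have dm2_num : dm2 m p' q' \is a fin_num.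
      by rewrite /dm2 maxEle; case: ifP => _; exact: dm_fin_num.
    have ln_mono r : P0 r -> (dm m r < +oo)%E -> (dm m r <= dm2 m p' q')%E ->
        ln (fine (dm m r)) <= ln (fine (dm2 m p' q')).
      move=> Pr r_fin le_r.
      have le_fine := fine_le (dm_fin_num r_fin) dm2_num le_r.
      have fine_gt0 := lt_le_trans ltr01 (fine_dm_ge1 (P0_distr _ Pr) r_fin).
      by rewrite ler_ln ?posrE// (lt_le_trans fine_gt0).
    (* [Delta_minus p' q'] vanishes where [q'] does, so the entropy lower bound on [f] there is
       controlled by the support of [q']. *)
    apply: le_trans (diff_le (cneg * ln (fine (dm m q'))) _ _ _ _ Pp Pq _ _ _) _.
    - by rewrite mulr_ge0 ?ln_dm_ge0//; exact: P0_distr.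
    - exact: dmp_fin.
    - exact: le_eps.
    - move=> /(P0_Delta _ _ Pp Pq)[_ PDm].
      apply: le_trans (f_bounds _ PDm).1; rewrite EFinN leeN2 EFinM.
      rewrite lee_wpmul2l ?lee_fin// marginal_entropies_le_ln_dm//.
      + exact: P0_distr.
      + exact: P0_distr.
      + move=> i qi0; rewrite /Delta_minus qi0 sub0r max_r ?mulr0// oppr_le0.
        by case: (P0_distr _ Pp).
    (* Both logarithms are at most that of [dm2], so the weights [cpos] and [cneg] add up to [C]. *)
    - rewrite lee_fin lerD2r mulrAC ler_wpM2r// addrC mulrDl lerD//.
      + by rewrite ler_wpM2l// ln_mono// le_max lexx orbT.
      + by rewrite ler_wpM2l// ln_mono// le_max lexx.
  have le_pq := half p q Pp Pq dm2_fin le_eps.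
  have le_qp := half q p Pq Pp.
  rewrite /dm2 maxC -/(dm2 m p q) TVC in le_qp.
  have {}le_qp := le_qp dm2_fin le_eps.
  move: (dm2_fin); rewrite /dm2 gt_max => /andP[dmp_fin dmq_fin].
  move: le_pq le_qp.
  have fin := f_fin_num P0_distr cpos_ge0 f_neqNy f_le.
  rewrite -(fineK (fin _ Pp dmp_fin)) -(fineK (fin _ Pq dmq_fin)).
  rewrite -!EFinB abse_EFin !lee_fin => le_pq le_qp.
  by rewrite ler_norml le_pq andbT lerNl opprB.
have eps_ge0 : 0 <= eps := le_trans (TV_ge0 p q) le_eps.
have ln_ge0 : 0 <= ln (fine (dm m p)) by rewrite ln_dm_ge0//; exact: P0_distr.
(* Nonnegativity of [f] at [Delta_minus p q] permits [K = 0], so no bound on [dm m q] is required;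
   [cpos] is then at most [C]. *)
apply: (le_trans (diff_le 0 p q eps _ _ _ _ _ _)) => //.
  by move=> /(P0_Delta _ _ Pp Pq)[_ /f_ge0]; rewrite oppr0.
rewrite addr0 lee_fin lerD2r mulrAC ler_wpM2r// ler_wpM2r// lerDr//.
Qed.
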